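(* Let $k$ be a field, $(\Lambda,G,\eta)$ an admissible set of data, $\Omega$ the set of conjugacy classes of partial elements, and for $\omega\in\Omega$ let $e_\omega$ be the formal (possibly infinite) sum of all partial elements belonging to $\omega$. Let $A=A(\Lambda,G,\eta)$ be the linear envelope over $k$ of all elements $e_\omega$, $\omega\in\Omega$. Then the multiplication of partial elements $(\lambda',h')(\lambda'',h'')=(\lambda'\wedge\lambda'',h'h'')$ induces a structure of associative commutative algebra on $A(\Lambda,G,\eta)$.
   Context: Admissible poset: a poset $\Lambda$ with a minimal element $0$, such that $\{\lambda'\mid\lambda'\preceq\lambda\}$ is finite for each $\lambda$ and each finite subset has a supremum in $\Lambda$. The supremum of $\lambda',\lambda''$ is denoted $\lambda'\wedge\lambda''$; with this operation $\Lambda$ is a commutative semigroup with unit $0$. Let $G$ be a group acting on $\Lambda$ by order automorphisms, let $\mathrm{Sub}(G)$ be the poset of subgroups of $G$ (ordered by inclusion, $G$ acting by conjugation), and let $\eta:\Lambda\to\mathrm{Sub}(G)$, $\lambda\mapsto G_\lambda$, be a morphism of posets compatible with the action of $G$ (so $G_{g\lambda}=gG_\lambda g^{-1}$). Put $L=\Lambda/G$. For $l',l''\in L$, $l'\wedge l''\subset L$ is the set of orbits of all elements $\lambda'\wedge\lambda''$, $\lambda'\in l'$, $\lambda''\in l''$. $G_l$ denotes the conjugacy class of the subgroups $G_\lambda$, $\lambda\in l$. A partial element is a pair $(\lambda,h)$ with $\lambda\in\Lambda$, $h\in G_\lambda$; $G$ acts on partial elements by $g(\lambda,h)=(g\lambda,ghg^{-1})$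 (conjugation), and the orbits are called conjugacy classes of partial elements. $(\Lambda,G,\eta)$ is an admissible set of data if $\Lambda$ is admissible and: (1) $G_0=\{e\}$; (2) every $G_\lambda$ is a finite subgroup; (3) $l'\wedge l''$ is a finite set for all $l',l''\in L$; (4) if $l'\wedge x=l''\wedge x$ for all $x\in L$ and $G_{l'}=G_{l''}$, then $l'=l''$; (5) for any $\lambda',\lambda''\preceq\lambda$, any two partial elements $(\lambda',h'),(\lambda'',h'')$ conjugated in $G$ are also conjugated in $G_\lambda$. It is assumed throughout that $G=\bigcup_{\lambda\in\Lambda}G_\lambda$.
   Formalization: Admissibility is taken to include that each $G_\lambda$ maps $\{\lambda'\preceq\lambda\}$ to itself (equivalently fixes $\lambda$), as condition (5) presupposes; under (1)–(5) alone commutativity can fail. *)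

(* Defs.v *)
From HB Require Import structures.
From mathcomp Require Import all_boot all_order all_fingroup all_algebra.
From mathcomp Require Import boolp classical_sets functions cardinality fsbigop.

Set Implicit Arguments.
Unset Strict Implicit.
Unset Printing Implicit Defensive.

Import Order.TTheory GRing.Theory.

Local Open Scope classical_set_scope.
Local Open Scope order_scope.
Local Open Scope group_scope.

(* A poset with least element in which finite subsets have suprema is a
   bJoinSemilatticeType. The supremum, often written as a wedge in this
   context, is the join `|` of the library. *)

Record poset_data (d : Order.disp_t) (Lam : bJoinSemilatticeType d)
    (G : groupType) := PosetData {
  pd_act : G -> Lam -> Lam;
  pd_act_one : forall x, pd_act 1 x = x;
  pd_act_mul : forall g h x, pd_act (g * h) x = pd_act g (pd_act h x);
  pd_act_le : forall g, {mono pd_act g : x y / x <= y};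
  pd_eta : Lam -> groupClosed G;
  pd_eta_le : forall x y, x <= y -> {subset pd_eta x <= pd_eta y};
  pd_eta_act : forall g x h,
    (h \in pd_eta (pd_act g x)) = (g^-1 * h * g \in pd_eta x)
}.

Section PartialElements.
Context {d : Order.disp_t} {Lam : bJoinSemilatticeType d} {G : groupType}.
Variable D : poset_data Lam G.

Definition orbit_of (x : Lam) : set Lam := [set pd_act D g x | g in [set: G]].

Definition orbits : set (set Lam) := [set orbit_of x | x in [set: Lam]].

Definition orbit_join (l1 l2 : set Lam) : set (set Lam) :=
  [set l | exists x1 x2, [/\ l1 x1, l2 x2 & l = orbit_of (x1 `|` x2)]].

Definition eta_class (l : set Lam) : set (set G) :=
  [set [set h | h \in pd_eta D x] | x in l].

Definition partial_elt := {p : Lam * G | p.2 \in pd_eta D p.1}.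

Definition pidx (p : partial_elt) : Lam := (val p).1.

Lemma pact_subproof (g : G) (p : partial_elt) :
  g * (val p).2 * g^-1 \in pd_eta D (pd_act D g (pidx p)).
Proof. by rewrite pd_eta_act !mulgA mulVg mul1g mulgVK; exact: (valP p). Qed.

Definition pact (g : G) (p : partial_elt) : partial_elt :=
  exist _ (pd_act D g (pidx p), g * (val p).2 * g^-1) (pact_subproof g p).

Lemma pmul_subproof (p q : partial_elt) :
  (val p).2 * (val q).2 \in pd_eta D (pidx p `|` pidx q).
Proof.
rewrite gpredM //.
- by apply: (pd_eta_le (leUl _ _)); exact: (valP p).
- by apply: (pd_eta_le (leUr _ _)); exact: (valP q).
Qed.

Definition pmul (p q : partial_elt) : partial_elt :=
  exist _ (pidx p `|` pidx q, (val p).2 * (val q).2) (pmul_subproof p q).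

Definition pclass (p : partial_elt) : set partial_elt :=
  [set pact g p | g in [set: G]].

Definition Omega : set (set partial_elt) :=
  [set pclass p | p in [set: partial_elt]].

Record admissible : Prop := Admissible {
  adm_below : forall x : Lam, finite_set [set y | y <= x];
  adm_bot : forall h, (h \in pd_eta D \bot) = (h == 1);
  adm_fin : forall x, finite_set [set h | h \in pd_eta D x];
  adm_join : forall l1 l2, orbits l1 -> orbits l2 ->
    finite_set (orbit_join l1 l2);
  adm_sep : forall l1 l2, orbits l1 -> orbits l2 ->
    (forall l, orbits l -> orbit_join l1 l = orbit_join l2 l) ->
    eta_class l1 = eta_class l2 -> l1 = l2;
  (* Conjugacy in the subgroup G_x = pd_eta D x of partial elements below x
     presupposes that G_x acts on them, i.e. preserves {y | y <= x}. The other
     conditions do not imply it, and without it commutativity can fail: take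
     Lam = {0} + S_3 + {top} with the elements of S_3 pairwise incomparable,
     G = S_3 acting on them by left translation, and G_x = G for x <> 0. *)
  adm_stable : forall x g y, g \in pd_eta D x -> y <= x -> pd_act D g y <= x;
  adm_conj : forall x (p q : partial_elt), pidx p <= x -> pidx q <= x ->
    (exists g, pact g p = q) -> exists2 g, g \in pd_eta D x & pact g p = q;
  adm_union : forall h, exists x, h \in pd_eta D x
}.

Local Open Scope ring_scope.
Variable k : fieldType.

Definition formal_sum : Type := partial_elt -> k^o.
HB.instance Definition _ := GRing.Lmodule.on formal_sum.

Definition class_sum (w : set partial_elt) : formal_sum :=
  fun p => (p \in w)%:R.

(* [\sum_(q \in _) _] is 0 on an infinite support; the index set below is
   shown to be finite as part of the main statement. *)
Definition formal_mul (f g : formal_sum) : formal_sum :=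
  fun p => \sum_(q \in [set q | pmul q.1 q.2 = p]) (f q.1 * g q.2 : k).

Definition class_span : {pred formal_sum} := fun f =>
  `[< exists (n : nat) (c : 'I_n -> k) (w : 'I_n -> set partial_elt),
        (forall i, Omega (w i)) /\ f = \sum_i c i *: class_sum (w i) >].

Lemma class_span_submod : submod_closed class_span.
Proof.
split.
  apply/asboolP; exists 0%N, (fun=> 0), (fun=> setT).
  by split=> [[]//|]; rewrite big_ord0.
move=> a f g /asboolP[m [c [u [Ou ->]]]] /asboolP[n [b [v [Ov ->]]]].
apply/asboolP; exists (m + n)%N.
exists (fun i => match fintype.split i with inl j => a * c j | inr j => b j end).
exists (fun i => match fintype.split i with inl j => u j | inr j => v j end).
split=> [i|]; first by case: (fintype.split i).
rewrite big_split_ord scaler_sumr; congr (_ + _); apply: eq_bigr => i _.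
  by rewrite (unsplitK (inl i)) scalerA.
by rewrite (unsplitK (inr i)).
Qed.

HB.instance Definition _ :=
  GRing.isSubmodClosed.Build k formal_sum class_span class_span_submod.

Definition class_alg := {f : formal_sum | f \in class_span}.
HB.instance Definition _ := [isSub of class_alg for val].
HB.instance Definition _ := [Choice of class_alg by <:].
HB.instance Definition _ := [SubChoice_isSubLmodule of class_alg by <:].

End PartialElements.

Arguments class_alg {d Lam G} D k.
Arguments class_span {d Lam G} D k _.
Arguments formal_sum {d Lam G} D k.

(* Main.v *)
(* Elements of the class algebra are exactly the class functions on partial
   elements supported on finitely many classes. All factorizations of a partial
   element over x lie over the finite set of indices below x, so the convolution
   product is a finite sum. It is associative because the product of partial
   elements is, and it is commutative on class functions because
   (h2 . p1) p2 = p2 p1, where h2 is the group component of p2: here h2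
   stabilizes every index above that of p2. Finiteness of l' /\ l'' bounds the
   number of classes in a product. *)

Require Import Defs.
From mathcomp Require Import all_boot all_order all_fingroup all_algebra.
From mathcomp Require Import finmap.
From mathcomp Require Import boolp classical_sets functions cardinality fsbigop.

Local Open Scope classical_set_scope.
Local Open Scope ring_scope.

Set Implicit Arguments.
Unset Strict Implicit.
Unset Printing Implicit Defensive.

Import Order.TTheory GRing.Theory.

(** Each pair [x], [y] from [s] is counted for exactly one [r], namely [m x y], which occurs once in
    [s] because [s] is closed under [m] and duplicate-free. *)
Lemma sum_fiber (T : eqType) (V : nmodType) (s : seq T) (m : T -> T -> T)
    (P : pred T) (F : T -> T -> V) :
    uniq s -> {in s &, forall x y, m x y \in s} ->
  \sum_(r <- s | P r) \sum_(x <- s) \sum_(y <- s | m x y == r) F x y =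
  \sum_(x <- s) \sum_(y <- s | P (m x y)) F x y.
Proof.
move=> us ms; rewrite exchange_big; apply: eq_big_seq => x xs.
under eq_bigr do rewrite big_mkcond.
rewrite exchange_big [RHS]big_mkcond; apply: eq_big_seq => y ys.
rewrite -big_mkcondr; case: ifP => Pxy.
  rewrite big_mkcond (bigD1_seq (m x y)) ?ms //= Pxy eqxx big1 ?addr0 // => r.
  by rewrite eq_sym => /negbTE ->; rewrite andbF.
by rewrite big1 // => r /andP[Pr /eqP e]; rewrite e Pr in Pxy.
Qed.

(** * The group action on indices and on partial elements *)

Section Action.
Context {d : Order.disp_t} {Lam : bJoinSemilatticeType d} {G : groupType}.
Variable D : poset_data Lam G.

Lemma pd_actK (g : G) : cancel (pd_act D g) (pd_act D g^-1%g).
Proof. by move=> x; rewrite -pd_act_mul mulVg pd_act_one. Qed.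

Lemma pd_actKV (g : G) : cancel (pd_act D g^-1%g) (pd_act D g).
Proof. by move=> x; rewrite -pd_act_mul mulgV pd_act_one. Qed.

(** Order automorphisms preserve suprema; the less direct inequality is pulled back along [g^-1]. *)
Lemma pd_act_join (g : G) (x y : Lam) :
  pd_act D g (x `|` y)%O = (pd_act D g x `|` pd_act D g y)%O.
Proof.
apply/eqP; rewrite eq_le leUx !pd_act_le leUl leUr !andbT.
rewrite -(pd_act_le D g^-1%g) pd_actK leUx.
by rewrite -[(x <= _)%O](pd_act_le D g) -[(y <= _)%O](pd_act_le D g)
   pd_actKV leUl leUr.
Qed.

Lemma partial_elt_eq (p q : partial_elt D) :
  pidx p = pidx q -> (val p).2 = (val q).2 -> p = q.
Proof.
rewrite /pidx => e1 e2; apply: val_inj.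
by move: e1 e2; case: (val p) => a b; case: (val q) => a' b' /= -> ->.
Qed.

Lemma pact1 (p : partial_elt D) : pact 1%g p = p.
Proof.
by apply: partial_elt_eq; rewrite /pidx/= ?pd_act_one // mul1g invg1 mulg1.
Qed.

Lemma pactM (g h : G) (p : partial_elt D) : pact (g * h)%g p = pact g (pact h p).
Proof. by apply: partial_elt_eq; rewrite /pidx/= ?pd_act_mul // invgM !mulgA. Qed.

Lemma pactK (g : G) : cancel (@pact _ _ _ D g) (pact g^-1%g).
Proof. by move=> p; rewrite -pactM mulVg pact1. Qed.

Lemma pactKV (g : G) : cancel (@pact _ _ _ D g^-1%g) (pact g).
Proof. by move=> p; rewrite -pactM mulgV pact1. Qed.

Lemma pact_pmul (g : G) (p q : partial_elt D) :
  pact g (pmul p q) = pmul (pact g p) (pact g q).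
Proof.
by apply: partial_elt_eq; rewrite /pidx/= ?pd_act_join // !mulgA mulgVK.
Qed.

Lemma pmulA : associative (@pmul _ _ _ D).
Proof.
by move=> p q r; apply: partial_elt_eq; rewrite /pidx/= ?joinA // mulgA.
Qed.

Lemma orbit_of_id (x : Lam) : orbit_of D x x.
Proof. by exists 1%g => //; exact: pd_act_one. Qed.

Lemma pclass_id (p : partial_elt D) : pclass p p.
Proof. by exists 1%g => //; exact: pact1. Qed.

Lemma pclass_pact (g : G) (p : partial_elt D) : pclass (pact g p) = pclass p.
Proof.
apply/seteqP; split=> _ [h _ <-].
  by exists (h * g)%g; rewrite // pactM.
by exists (h * g^-1)%g; rewrite // pactM pactK.
Qed.

Lemma pclass_eq (p q : partial_elt D) : pclass q p -> pclass p = pclass q.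
Proof. by case=> g _ <-; exact: pclass_pact. Qed.

(** * Stabilizers and finiteness in admissible data *)

Hypothesis hD : admissible D.

(** Stability under [g] gives [g x <= x]; stability under [g^-1] gives the reverse inequality after
    applying [g]. *)
Lemma stabilizer_fix (x : Lam) (g : G) : g \in pd_eta D x -> pd_act D g x = x.
Proof.
move=> gx; apply/eqP; rewrite eq_le (adm_stable hD gx (lexx x)) /=.
rewrite -(pd_act_le D g^-1%g) pd_actK (adm_stable hD _ (lexx x)) //.
by rewrite gpredV.
Qed.

(** With [h] the group component of [q], conjugation by [h] is undone by the right factor [h]. For
    indices, [h] fixes that of [q], so the left-hand index is the [h]-translate of the join, and [h]
    fixes the join too since its group contains that of [q]. *)
Lemma pmul_swap (p q : partial_elt D) : pmul (pact (val q).2 p) q = pmul q p.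
Proof.
have qx : (val q).2 \in pd_eta D (pidx q) := valP q.
apply: partial_elt_eq; last by rewrite /= mulgVK.
change ((pd_act D (val q).2 (pidx p) `|` pidx q)%O = (pidx q `|` pidx p)%O).
rewrite -{1}[pidx q](stabilizer_fix qx) -pd_act_join joinC.
by apply: stabilizer_fix; apply: (pd_eta_le (leUl _ _)); exact: qx.
Qed.

(** Over each index there are only finitely many partial elements, because its group is finite. *)
Lemma finite_pidx_in (A : set Lam) :
  finite_set A -> finite_set [set p : partial_elt D | A (pidx p)].
Proof.
move=> finA.
have finT : finite_set (\bigcup_(x in A) ([set x] `*` [set h | h \in pd_eta D x])).
  apply: bigcup_finite => // x _; apply: finite_setX; first exact: finite_set1.
  exact: adm_fin hD x.
apply: sub_finite_set (finite_preimage (f := val) _ finT); last first.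
  by move=> p q _ _; exact: val_inj.
by move=> p /= Ap; exists (pidx p) => //; split=> //; exact: (valP p).
Qed.

Lemma finite_below (z : Lam) : finite_set [set p : partial_elt D | (pidx p <= z)%O].
Proof. exact: (finite_pidx_in (adm_below hD z)). Qed.

Lemma finite_pmul_fiber (p : partial_elt D) :
  finite_set [set q : partial_elt D * partial_elt D | pmul q.1 q.2 = p].
Proof.
apply: sub_finite_set (finite_setX (finite_below (pidx p)) (finite_below (pidx p))).
by move=> [q r] /= <-; split; rewrite /= ?leUl ?leUr.
Qed.

(** Every class lying over an orbit in [L] has a member over one chosen index of that orbit, so
    finitely many indices suffice. *)
Lemma finite_pclass_in (L : set (set Lam)) : finite_set L ->
  finite_set [set pclass p | p in [set p : partial_elt D | L (orbit_of D (pidx p))]].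
Proof.
move=> finL.
have : finite_set [set pclass p |
    p in [set p : partial_elt D | [set xget \bot%O l | l in L] (pidx p)]].
  exact/finite_image/finite_pidx_in/finite_image.
apply: sub_finite_set => _ [p /= Lp <-].
(* The default [\bot] is not returned by failure of the choice here: the orbit of [pidx p] is
   nonempty. The element [g] moves [p] over the chosen index. *)
have [g _ gp] : orbit_of D (pidx p) (xget \bot%O (orbit_of D (pidx p))).
  by apply: xgetPex; exists (pidx p); exact: orbit_of_id.
exists (pact g p); last exact: pclass_pact.
by exists (orbit_of D (pidx p)).
Qed.

Lemma finite_pmul_pclass (p q : partial_elt D) :
  finite_set [set pclass (pmul p' q') | p' in pclass p & q' in pclass q].
Proof.
have := finite_pclass_in (adm_join hD (l1 := orbit_of D (pidx p))
  (l2 := orbit_of D (pidx q)) _ _).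
move=> /(_ (ex_intro2 _ _ _ I erefl) (ex_intro2 _ _ _ I erefl)).
apply: sub_finite_set => _ [_ [g _ <-] [_ [h _ <-] <-]].
exists (pmul (pact g p) (pact h q)) => //=.
exists (pd_act D g (pidx p)), (pd_act D h (pidx q)).
by split=> //; [exists g | exists h].
Qed.

End Action.

(** * Class functions and the span of the class sums *)

Section FormalProduct.
Context {d : Order.disp_t} {Lam : bJoinSemilatticeType d} {G : groupType}.
Variables (D : poset_data Lam G) (k : fieldType).
Implicit Types f g h : formal_sum D k.

Definition class_function f := forall t p, f (pact t p) = f p.

Definition support_classes f : set (set (partial_elt D)) :=
  [set pclass p | p in [set p | f p != 0]].

(** Conversely to the evident direction, an invariant [f] is the sum, over the finitely many classes
    in its support, of its value on the class times the class sum. *)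
Lemma class_spanP f :
  f \in class_span D k <-> class_function f /\ finite_set (support_classes f).
Proof.
split=> [/asboolP[n [c [w [Ow ->]]]]|[invf finf]].
  have sumE p : (\sum_i c i *: class_sum k (w i)) p = \sum_i c i * (p \in w i)%:R.
    by elim/big_rec2: _ => // i x y _ <-.
  split=> [t p|].
    rewrite !sumE; apply: eq_bigr => i _; congr (_ * (_ : bool)%:R).
    have [q _ <-] := Ow i; apply/idP/idP; rewrite !inE => /pclass_eq e.
      by rewrite -e pclass_pact; exact: pclass_id.
    by rewrite -e; exists t.
  have finw : finite_set (range w) by exact/finite_image/finite_finset.
  apply: (sub_finite_set _ finw) => _ [p /= fp <-].
  have [i pi] : exists i, p \in w i.
    apply: contrapT => np; move/eqP: fp; apply; rewrite sumE big1 // => i _.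
    by case: (boolP (p \in w i)) => [pi|_]; [case: np; exists i|rewrite mulr0].
  exists i => //; move: pi; have [q _ <-] := Ow i.
  by rewrite inE => /pclass_eq.
(* The list [r] enumerates the support without repetition; [e] below picks a representative of each
   class, where the coefficient is read off. *)
apply/asboolP; pose r := enum_fset (fset_set (support_classes f)).
have rP w : (w \in r) = (w \in support_classes f) by rewrite in_fset_set.
have wP (i : 'I_(size r)) :
    exists p, f p != 0 /\ tnth (in_tuple r) i = pclass p.
  have := mem_tnth i (in_tuple r); rewrite /= rP inE => -[p fp <-].
  by exists p.
have [e eP] := choice wP.
exists (size r), (f \o e), (tnth (in_tuple r)); split=> [i|].
  by rewrite (eP i).2; exists (e i).
apply/funext => p.
have -> : (\sum_(i < size r) (f \o e) i *: class_sum k (tnth (in_tuple r) i)) p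
    = \sum_(i < size r) f (e i) * (p \in pclass (e i))%:R.
  elim/big_rec2: _ => // i x y _ <-; congr (_ * (_ \in _)%:R + _).
  by rewrite (eP i).2.
have termE i : f (e i) * (p \in pclass (e i))%:R
    = if pclass p == tnth (in_tuple r) i then f p else 0.
  rewrite (eP i).2; case: eqP => [pe|npe].
    have pp : pclass (e i) p by rewrite -pe; exact: pclass_id.
    by rewrite mem_set // mulr1; have [t _ <-] := pp; rewrite invf.
  by rewrite memNset ?mulr0 // => /pclass_eq.
under eq_bigr do rewrite termE.
rewrite -big_mkcond /=.
(* If [f p] is nonzero, the class of [p] occurs exactly once in [r], so a single term [f p]
   survives. *)
have [fp0|fp] := eqVneq (f p) 0; first by rewrite fp0 big1.
have : pclass p \in r by rewrite rP inE; exists p.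
move=> /(tnthP (in_tuple r))[i pi].
rewrite (big_pred1 i) // => j; rewrite /= pi.
rewrite !(tnth_nth (pclass p)) /= nth_uniq //; first by rewrite eq_sym.
exact: fset_uniq.
Qed.

(** * The convolution product of class functions *)

Hypothesis hD : admissible D.

Lemma formal_mulC f g : class_function f -> formal_mul f g = formal_mul g f.
Proof.
move=> invf; apply/funext => p; rewrite /formal_mul.
(* By [pmul_swap] this exchange of factors, twisted by conjugation, permutes the factorizations of
   [p]; the invariance of [f] absorbs the twist. *)
pose h (q : partial_elt D * partial_elt D) := (pact (val q.1).2 q.2, q.1).
rewrite (reindex_fsbig h [set q | pmul q.1 q.2 = p]) /=.
  by apply: eq_fsbigr => q _; rewrite invf mulrC.
split=> [q /=||[q r] /= qr]; first by rewrite pmul_swap.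
  move=> [q r] [q' r'] _ _ hq; have /= qq' := congr1 snd hq.
  by have /= := congr1 fst hq; rewrite qq' => /(can_inj (pactK _)) ->.
exists (r, pact (val r).2^-1%g q); last by rewrite /h /= pactKV.
by rewrite /= -(pmul_swap hD) pactKV.
Qed.

Lemma formal_mul_class_function f g :
  class_function f -> class_function g -> class_function (formal_mul f g).
Proof.
move=> invf invg t p; rewrite /formal_mul.
(* The diagonal action of [t] carries the factorizations of [p] bijectively to those of
   [pact t p]. *)
pose h (q : partial_elt D * partial_elt D) := (pact t q.1, pact t q.2).
rewrite (reindex_fsbig h [set q | pmul q.1 q.2 = p]) /=.
  by apply: eq_fsbigr => q _; rewrite invf invg.
split=> [q /= <-||[q r] /= qr]; first by rewrite pact_pmul.
  move=> [q r] [q' r'] _ _ hq.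
  have /= /(can_inj (pactK _)) -> := congr1 fst hq.
  by have /= /(can_inj (pactK _)) -> := congr1 snd hq.
exists (pact t^-1%g q, pact t^-1%g r); last by rewrite /h /= !pactKV.
by rewrite /= -pact_pmul qr pactK.
Qed.

(** A nonzero value of the product at [p] forces a factorization of [p] into supports of [f] and
    [g], so the class of [p] occurs in a product of two of their finitely many classes. *)
Lemma formal_mul_span f g : f \in class_span D k -> g \in class_span D k ->
  formal_mul f g \in class_span D k.
Proof.
move=> /class_spanP[invf finf] /class_spanP[invg fing]; apply/class_spanP.
split; first exact: formal_mul_class_function.
have : finite_set (\bigcup_(w in support_classes f `*` support_classes g)
    [set pclass (pmul p q) | p in w.1 & q in w.2]).
  apply: bigcup_finite; first exact: finite_setX.
  by move=> [_ _] /= [[p _ <-] [q _ <-]]; exact: finite_pmul_pclass.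
apply: sub_finite_set => _ [p /= fgp <-].
have [q [r [qr fq gr]]] : exists q r, [/\ pmul q r = p, f q != 0 & g r != 0].
  apply: contrapT => nqr; move/eqP: fgp; apply.
  apply: fsbig1 => -[q r] /= qr; apply/eqP; rewrite mulf_eq0.
  by apply: contra_notT nqr; rewrite negb_or => /andP[fq gr]; exists q, r.
exists (pclass q, pclass r); first by split; [exists q | exists r].
exists q; first exact: pclass_id.
by exists r; [exact: pclass_id | rewrite qr].
Qed.

Lemma formal_mul_linear f : linear (formal_mul f).
Proof.
move=> a g h; apply/funext => p; rewrite /formal_mul.
have -> (F H : formal_sum D k) : (a *: F + H) p = a * F p + H p by [].
rewrite mulr_fsumr -fsbig_split; last exact: finite_pmul_fiber.
by apply: eq_fsbigr => q _; rewrite /= mulrDr mulrCA.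
Qed.

(** * Associativity through sums over a finite set closed under multiplication *)

Definition below (z : Lam) : seq (partial_elt D) :=
  fset_set [set p : partial_elt D | (pidx p <= z)%O].

Lemma mem_below z p : (p \in below z) = (pidx p <= z)%O.
Proof.
rewrite /below in_fset_set; last exact: finite_below.
by apply/idP/idP; rewrite inE.
Qed.

Lemma pmul_below z : {in below z &, forall p q, pmul p q \in below z}.
Proof. by move=> p q; rewrite !mem_below leUx => -> ->. Qed.

(** Factors of an element below [z] are themselves below [z]. As [z] need not be the index of [p],
    nested products can all be summed over one list. *)
Lemma formal_mulE z f g p : p \in below z -> formal_mul f g p =
  \sum_(q <- below z) \sum_(r <- below z | pmul q r == p) (f q * g r : k).
Proof.
rewrite mem_below => pz.
pose s := [seq q <- [seq (x, y) | x <- below z, y <- below z] | pmul q.1 q.2 == p].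
have us : uniq s.
  by apply/filter_uniq/allpairs_uniq; rewrite ?fset_uniq // => -[? ?] [? ?].
rewrite /formal_mul (_ : [set q | pmul q.1 q.2 = p] = [set` s]).
  rewrite -fsbig_seq // big_filter big_mkcond big_allpairs.
  by apply: eq_bigr => q _; rewrite [RHS]big_mkcond.
apply/seteqP; split=> -[q r] /=; rewrite mem_filter /=; last by case/andP=> /eqP.
move=> qr; rewrite qr eqxx /= allpairs_f // mem_below (le_trans _ pz) // -qr.
  exact: leUl.
exact: leUr.
Qed.

Lemma formal_mulA f g h :
  formal_mul f (formal_mul g h) = formal_mul (formal_mul f g) h.
Proof.
apply/funext => p; pose s := below (pidx p).
have ps : p \in s by rewrite mem_below.
rewrite !(formal_mulE (z := pidx p)) // -/s.
(* Both sides equal the sum over all triples in [s] with product [p]; the left side groups them by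
   [r = y z]. *)
transitivity (\sum_(x <- s) \sum_(y <- s) \sum_(z <- s | pmul (pmul x y) z == p)
   (f x * g y * h z : k)).
  apply: eq_bigr => x _.
  transitivity (\sum_(r <- s | pmul x r == p) \sum_(y <- s)
      \sum_(z <- s | pmul y z == r) (f x * g y * h z : k)).
    rewrite !(big_seq_cond (fun r => _ == p)).
    apply: eq_bigr => r /andP[rs _]; rewrite (formal_mulE _ _ rs) mulr_sumr.
    apply: eq_bigr => y _; rewrite mulr_sumr.
    by apply: eq_bigr => z _; rewrite mulrA.
  rewrite sum_fiber ?fset_uniq //; last exact: pmul_below.
  by apply: eq_bigr => y _; apply: eq_bigl => z; rewrite pmulA.
(* The right side groups the same triples by [r = x y], after the sum over [z] is moved
   outermost. *)
transitivity (\sum_(z <- s) \sum_(r <- s | pmul r z == p)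
    \sum_(x <- s) \sum_(y <- s | pmul x y == r) (f x * g y * h z : k)).
  transitivity (\sum_(z <- s) \sum_(x <- s)
    \sum_(y <- s | pmul (pmul x y) z == p) (f x * g y * h z : k)).
    rewrite [RHS]exchange_big; apply: eq_bigr => x _.
    under eq_bigr do rewrite big_mkcond.
    by rewrite exchange_big; apply: eq_bigr => z _; rewrite [LHS]big_mkcond.
  apply: eq_bigr => z _; rewrite (sum_fiber (fun r => pmul r z == p)) //.
    exact: fset_uniq.
  exact: pmul_below.
under eq_bigr do rewrite big_mkcond.
rewrite exchange_big; apply: eq_big_seq => r rs; rewrite [RHS]big_mkcond.
apply: eq_bigr => z _; case: ifP => // _.
rewrite (formal_mulE _ _ rs) mulr_suml.
by apply: eq_bigr => x _; rewrite mulr_suml.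
Qed.

End FormalProduct.

(** * The algebra structure on the span of the class sums *)

Theorem theorem3p1 (k : fieldType) (d : Order.disp_t)
    (Lam : bJoinSemilatticeType d) (G : groupType) (D : poset_data Lam G)
    (hD : admissible D) :
  (forall p : partial_elt D,
     finite_set [set q : partial_elt D * partial_elt D | pmul q.1 q.2 = p]) /\
  exists mul : class_alg D k -> class_alg D k -> class_alg D k,
    [/\ forall a b, val (mul a b) = formal_mul (val a) (val b),
        forall a, linear (mul a),
        forall b, linear (mul ^~ b),
        associative mul
      & commutative mul].
Proof.
split; first exact: finite_pmul_fiber.
pose mul (a b : class_alg D k) : class_alg D k :=
  exist (fun f => f \in class_span D k) _ (formal_mul_span hD (valP a) (valP b)).
have mulC : commutative mul.
  move=> a b; apply: val_inj; apply: (formal_mulC hD).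
  by have /class_spanP[] := valP a.
have mul_linear a : linear (mul a).
  by move=> c b b'; apply: val_inj; exact: (formal_mul_linear hD).
(* Linearity in the left argument follows from linearity in the right one by commutativity. *)
exists mul; split=> // [b c a a'|a b c].
  by rewrite !(mulC _ b); exact: mul_linear.
by apply: val_inj; exact: (formal_mulA hD).
Qed.
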